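(* Let $F\in V'$ with $F\ge0$. Suppose that: (i) the sequence $\{f_n\}$ in $H^+$, with $0\le f_n\le F$ for all $n\in\mathbb{N}$, is non-increasing and $\lim_{n\to\infty}f_n=f^*$ in $H$ for some $f^*\in H$; (ii) the increasing map $\Phi:H^+\to H^+$ satisfies: if $\{v_n\}$ is bounded in $V$ and $v_n\downarrow v$ in $H$, then $\Phi(v_n)\to\Phi(v)$ in $H$. Then $$\mathbf{M}(f_n)\downarrow\mathbf{M}(f^* )\ \text{in } H,\quad\text{and}\quad\mathbf{M}(f_n)\to\mathbf{M}(f^* )\ \text{in } V.$$
   Context: $(V,H,V')$ is a Gelfand triple of Hilbert spaces: $V\hookrightarrow H\hookrightarrow V'$ with dense and continuous embeddings, $H$ identified with $H'$; $\langle\cdot,\cdot\rangle$ is the duality pairing of $V'$ and $V$, $(\cdot,\cdot)$ the inner product of $H$. $H^+\subset H$ is a closed convex cone with $H^+=\{v\in H:(v,y)\ge0\ \forall y\in H^+\}$, and $x\le y$ means $y-x\in H^+$. For $x\in H$, $x^+$ is the orthogonal projection of $x$ onto $H^+$ and $x^-:=x^+-x$; $\sup(x,y):=x+(y-x)^+$, $\inf(x,y):=x-(x-y)^+$. It is assumed that $y\in V$ implies $y^+\in V$, and $\|y^+\|_V\le M\|y\|_V$ for all $y\in V$ and some $M>0$. $V$ and $H$ are spaces of functions $h:\Omega\to\mathbb{R}$ on an open set $\Omega\subset\mathbb{R}^N$, with $L^\infty(\Omega)\hookrightarrow H$ densely and continuously, and $L^\infty(\Omega)$ inherits the order of $H$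 (prototype: $V=H_0^1(\Omega)$, $H=L^2(\Omega)$, $H^+$ the a.e. non-negative functions). In $V'$, $f_1\le f_2$ means $\langle f_2-f_1,v\rangle\ge0$ for all $v\in V$ with $v\ge0$. For $x\le y$ in $H$, $[x,y]:=\{z\in H:x\le z\le y\}$. $z_n\downarrow z$ in $H$ means $z_n\ge z_{n+1}$ for all $n$ and $z_n\to z$ in $H$. $A:V\to V'$ (possibly nonlinear) is: homogeneous of order one ($A(tu)=tA(u)$ for $u\in V$, $t>0$); Lipschitz continuous ($\|A(u)-A(v)\|_{V'}\le C\|u-v\|_V$); strongly monotone ($\langle A(u)-A(v),u-v\rangle\ge c\|u-v\|_V^2$ for some $c>0$); and T-monotone ($\langle A(u)-A(v),(u-v)^+\rangle\ge0$ for all $u,v\in V$, with equality if and only if $(u-v)^+=0$). $\Phi:H^+\to H^+$ is increasing ($0\le v\le w$ implies $\Phi(v)\le\Phi(w)$), extended to $H$ by $x\mapsto\Phi(x^+)$ when needed. For $\psi\in H^+$, $\mathbf{K}(\psi):=\{v\in V:v\le\psi\}$; for $f\in V'$, $S(f,\psi)$ is the unique $y\in\mathbf{K}(\psi)$ with $\langle A(y)-f,v-y\rangle\ge0$ for all $v\in\mathbf{K}(\psi)$. Let $\overline{y}\in V$ be the unique solution of $A(\overline{y})=F$. For $f\in V'$ with $0\le f\le F$, the set of fixed points of $y\mapsto S(f,\Phi(y))$ in $[0,\overline{y}]$ is non-empty and has a largest element, denoted $\mathbf{M}(f)$.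
   Formalization: It is additionally assumed that sup(x,y) = x+(y-x)^+ is the least upper bound of x and y; self-duality of H^+ alone does not give this, and without it the claim fails (H^+ with a Lorentz-cone summand, A the identity, Φ constant). *)

(* Defs.v *)
From HB Require Import structures.
From mathcomp Require Import all_boot all_order all_algebra.
From mathcomp Require Import all_classical all_reals all_analysis.
From mathcomp Require Import lra.

Set Implicit Arguments.
Unset Strict Implicit.
Unset Printing Implicit Defensive.

Import Order.TTheory GRing.Theory Num.Theory.
Import numFieldNormedType.Exports.

Local Open Scope classical_set_scope.
Local Open Scope ring_scope.

(* The topological dual of a normed space. *)
Record dual (R : realType) (E : normedModType R) := Dual {
  dual_lin :> {linear E -> R^o};
  dual_continuous : continuous dual_lin }.

(* The operator norm, on bare functions so that it applies to a difference of
   two elements of the dual. *)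
Definition dual_norm (R : realType) (E : normedModType R) (f : E -> R) : R :=
  sup [set `|f v| | v in [set v | `|v| <= 1]].

(* Two real Hilbert spaces (complete normed spaces whose norm comes from an
   inner product) and a dense continuous embedding V -> H.  The embedding
   H -> V' is [to_dual] below. *)
Record gelfand_triple (R : realType) (V H : completeNormedModType R) :=
  GelfandTriple {
    dotV : {dot V for idfun};
    dotV_norm : forall v : V, dotV v v = `|v| ^+ 2;
    dotH : {dot H for idfun};
    dotH_norm : forall x : H, dotH x x = `|x| ^+ 2;
    emb : {linear V -> H};
    emb_injective : injective emb;
    emb_continuous : continuous emb;
    emb_dense : dense (range emb) }.

Lemma dotH_le_sqr (R : realType) (V H : completeNormedModType R)
    (G : gelfand_triple V H) (x y : H) :
  `|dotH G x y| <= `|x| ^+ 2 + `|y| ^+ 2.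
Proof.
have dC (u v : H) : dotH G u v = dotH G v u.
  by have := @hermC _ false idfun H (dotH G) u v; rewrite expr0 mul1r.
have hD : 0 <= dotH G (x + y) (x + y) by rewrite dotH_norm sqr_ge0.
have hB : 0 <= dotH G (x - y) (x - y) by rewrite dotH_norm sqr_ge0.
have sx : 0 <= `|x| ^+ 2 by exact: sqr_ge0.
have sy : 0 <= `|y| ^+ 2 by exact: sqr_ge0.
move: hD hB.
rewrite !(linearDl, linearDr, linearNl, linearNr) /= !dotH_norm.
rewrite (dC y x) => hD hB.
by rewrite ler_norml; apply/andP; split; lra.
Qed.

Definition to_dual_fun (R : realType) (V H : completeNormedModType R)
    (G : gelfand_triple V H) (x : H) (v : V) : R^o := dotH G x (emb G v).

Lemma to_dual_linear (R : realType) (V H : completeNormedModType R)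
    (G : gelfand_triple V H) (x : H) : linear (to_dual_fun G x).
Proof. by move=> a u v; rewrite /to_dual_fun !(linearP, linearPr). Qed.

HB.instance Definition _ (R : realType) (V H : completeNormedModType R)
    (G : gelfand_triple V H) (x : H) :=
  GRing.isLinear.Build R V R^o *:%R (to_dual_fun G x) (to_dual_linear G x).

Lemma to_dual_continuous (R : realType) (V H : completeNormedModType R)
    (G : gelfand_triple V H) (x : H) : continuous (to_dual_fun G x).
Proof.
apply: bounded_linear_continuous.
have /continuous_linear_bounded : {for 0, continuous (emb G)}.
  exact: emb_continuous.
move=> /(_ 0) [M [Mreal hM]].
exists (`|x| ^+ 2 + (`|M| + 1) ^+ 2); split; first exact: num_real.
move=> r xr; apply: filterS (hM (`|M| + 1) _) => [v /= hv|]; last first.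
  by rewrite (le_lt_trans (ler_norm M)) // ltrDl.
apply: (le_trans (dotH_le_sqr G x (emb G v))); apply: ltW.
apply: le_lt_trans xr; rewrite lerD2l.
by rewrite ler_pXn2r ?nnegrE ?addr_ge0.
Qed.

(* The embedding H -> V' given by the identification of H with H'. *)
Definition to_dual (R : realType) (V H : completeNormedModType R)
    (G : gelfand_triple V H) (x : H) : dual V :=
  @Dual R V (to_dual_fun G x) (@to_dual_continuous R V H G x).

Definition is_projection (R : realType) (H : normedModType R)
    (C : set H) (x p : H) : Prop :=
  C p /\ forall z, C z -> `|x - p| <= `|x - z|.

(* The positive part x^+ for the cone C; the default value of [xget] is
   irrelevant for a closed convex cone of a Hilbert space. *)
Definition pos (R : realType) (H : normedModType R) (C : set H) (x : H) : H :=
  xget 0 [set p | is_projection C x p].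

Definition hle (R : realType) (H : normedModType R) (C : set H) (x y : H) :=
  C (y - x).

Definition hsup (R : realType) (H : normedModType R) (C : set H) (x y : H) :=
  x + pos C (y - x).

Definition dle (R : realType) (V H : completeNormedModType R)
    (G : gelfand_triple V H) (C : set H) (f g : V -> R) : Prop :=
  forall v, hle C 0 (emb G v) -> 0 <= g v - f v.

(* [ordc_sup] says that x + (y - x)^+ is the least upper bound of x and y; that
   it is an upper bound, and the dual statement for x - (x - y)^+, follow from
   the other fields.  For a self-dual cone alone this can fail: it does for the
   Lorentz cone of R^3. *)
Record order_cone (R : realType) (V H : completeNormedModType R)
    (G : gelfand_triple V H) (C : set H) : Prop := OrderCone {
  ordc_closed : closed C;
  ordc_convex : forall x y (a b : R), C x -> C y -> 0 <= a -> 0 <= b ->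
    C (a *: x + b *: y);
  ordc_selfdual : C = [set v | forall y, C y -> 0 <= dotH G v y];
  ordc_sup : forall x y z, hle C x z -> hle C y z -> hle C (hsup C x y) z;
  ordc_posV : exists2 K : R, 0 < K & forall y : V, exists2 w : V,
    emb G w = pos C (emb G y) & `|w| <= K * `|y| }.

(* R^N with its Borel sigma-algebra. *)
Definition borelRn (R : realType) (N : nat) :=
  g_sigma_algebraType (@open 'rV[R]_N).

(* Characterizes the Lebesgue measure on the Borel sets of R^N. *)
Definition is_lebesgue (R : realType) (N : nat)
    (mu : {measure set (borelRn R N) -> \bar R}) : Prop :=
  forall a b : 'rV[R]_N, (forall i, a 0 i <= b 0 i) ->
    mu [set x : 'rV[R]_N | forall i, a 0 i <= x 0 i <= b 0 i] =
    (\prod_(i < N) (b 0 i - a 0 i))%:E.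

Definition Linfty_norm (R : realType) (N : nat)
    (mu : {measure set (borelRn R N) -> \bar R}) (Omega : set (borelRn R N))
    (u : borelRn R N -> R) : \bar R :=
  Lnorm mu +oo%E (fun x => (u x * \1_Omega x)%:E).

Definition Linfty (R : realType) (N : nat)
    (mu : {measure set (borelRn R N) -> \bar R}) (Omega : set (borelRn R N))
    (u : borelRn R N -> R) : Prop :=
  measurable_fun Omega u /\ (Linfty_norm mu Omega u < +oo)%E.

(* H, and V through its embedding, as a space of functions on Omega modulo
   equality a.e.: [rep h] is a representative of h (its values outside Omega
   are irrelevant).  The inclusion of L^oo in H identifies u with the h such
   that rep h = u a.e. on Omega; L^oo is ordered by the restriction of the
   order of H. *)
Record function_space (R : realType) (H : normedModType R) (N : nat)
    (mu : {measure set (borelRn R N) -> \bar R}) (Omega : set 'rV[R]_N)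
    (rep : H -> borelRn R N -> R) : Prop := FunctionSpace {
  funs_open : open Omega;
  funs_lebesgue : is_lebesgue mu;
  funs_linear : forall (a : R) (x y : H),
    rep (a *: x + y) = (fun t => a * rep x t + rep y t) %[ae mu in Omega];
  funs_inj : forall x : H, rep x = cst 0 %[ae mu in Omega] -> x = 0;
  funs_Linfty : forall u, Linfty mu Omega u ->
    exists h : H, rep h = u %[ae mu in Omega];
  funs_Linfty_continuous : exists K : R, forall (u : borelRn R N -> R) (h : H),
    Linfty mu Omega u -> rep h = u %[ae mu in Omega] ->
    (`|h|%:E <= K%:E * Linfty_norm mu Omega u)%E;
  funs_Linfty_dense :
    dense [set h : H | exists2 u, Linfty mu Omega u &
                         rep h = u %[ae mu in Omega]] }.

(* In [opm_Tmonotone], w is (u - v)^+, which lies in V by [ordc_posV]. *)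
Record operator (R : realType) (V H : completeNormedModType R)
    (G : gelfand_triple V H) (C : set H) (A : V -> dual V) : Prop := Operator {
  opm_homogeneous : forall (t : R) (u v : V), 0 < t -> A (t *: u) v = t * A u v;
  opm_lipschitz : exists K : R, forall u v : V,
    dual_norm (fun w => A u w - A v w) <= K * `|u - v|;
  opm_strongly_monotone : exists2 c : R, 0 < c & forall u v : V,
    c * `|u - v| ^+ 2 <= A u (u - v) - A v (u - v);
  opm_Tmonotone : forall u v w : V, emb G w = pos C (emb G (u - v)) ->
    0 <= A u w - A v w /\ (A u w - A v w = 0 <-> w = 0) }.

Definition increasing_on_cone (R : realType) (H : normedModType R)
    (C : set H) (Phi : H -> H) : Prop :=
  (forall x, C x -> C (Phi x)) /\
  (forall x y, hle C 0 x -> hle C x y -> hle C (Phi x) (Phi y)).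

(* The extension x |-> Phi (x^+) to H of a map defined on the cone. *)
Definition ext (R : realType) (H : normedModType R) (C : set H)
    (Phi : H -> H) (x : H) : H := Phi (pos C x).

Definition obstacle_set (R : realType) (V H : completeNormedModType R)
    (G : gelfand_triple V H) (C : set H) (psi : H) : set V :=
  [set v | hle C (emb G v) psi].

Definition is_obstacle_solution (R : realType)
    (V H : completeNormedModType R) (G : gelfand_triple V H) (C : set H)
    (A : V -> dual V) (f : dual V) (psi : H) (y : V) : Prop :=
  obstacle_set G C psi y /\
  forall v, obstacle_set G C psi v -> 0 <= A y (v - y) - f (v - y).

(* S(f, psi): the solution exists and is unique for psi in the cone and A an
   [operator], so the default value of [xget] is not used. *)
Definition obstacle_solution (R : realType) (V H : completeNormedModType R)
    (G : gelfand_triple V H) (C : set H) (A : V -> dual V)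
    (f : dual V) (psi : H) : V :=
  xget 0 [set y | is_obstacle_solution G C A f psi y].

Definition fixed_points (R : realType) (V H : completeNormedModType R)
    (G : gelfand_triple V H) (C : set H) (A : V -> dual V) (Phi : H -> H)
    (ybar : V) (f : dual V) : set V :=
  [set y | [/\ hle C 0 (emb G y), hle C (emb G y) (emb G ybar) &
            y = obstacle_solution G C A f (ext C Phi (emb G y))]].

Definition is_largest (R : realType) (V H : completeNormedModType R)
    (G : gelfand_triple V H) (C : set H) (B : set V) (m : V) : Prop :=
  B m /\ forall y, B y -> hle C (emb G y) (emb G m).

(* M(f), the largest fixed point of y |-> S(f, Phi(y)) in [0, ybar]; it exists
   for 0 <= f <= F = A(ybar), so the default value of [xget] is not used. *)
Definition max_solution (R : realType) (V H : completeNormedModType R)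
    (G : gelfand_triple V H) (C : set H) (A : V -> dual V) (Phi : H -> H)
    (ybar : V) (f : dual V) : V :=
  xget 0 [set m | is_largest G C (fixed_points G C A Phi ybar f) m].

Definition decreases_to (R : realType) (H : normedModType R) (C : set H)
    (z_ : nat -> H) (z : H) : Prop :=
  (forall n, hle C (z_ n.+1) (z_ n)) /\ z_ n @[n --> \oo] --> z.

(* Main.v *)
Require Import Defs.
From HB Require Import structures.
From mathcomp Require Import all_boot all_order all_algebra.
From mathcomp Require Import all_classical all_reals all_analysis.
From mathcomp Require Import ring lra.

Set Implicit Arguments.
Unset Strict Implicit.
Unset Printing Implicit Defensive.

Import Order.TTheory GRing.Theory Num.Theory.
Import numFieldNormedType.Exports.

Local Open Scope classical_set_scope.
Local Open Scope ring_scope.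

(* M(f) is the largest fixed point of the increasing map x |-> S(f, Phi(x)) of
   the order-complete interval [0, ybar] of H, hence the largest of its
   subsolutions x <= S(f, Phi(x)); as S is increasing in f, so is M. Thus
   y_n = M(f_n) decreases in H, while testing with 0 bounds it in V, so its limit
   is some p in V and y_n converges weakly to p in V. Since p <= y_n, the set
   K(Phi(p)) lies in every K(Phi(y_n)); testing the inequality for y_n with p and
   using strong monotonicity gives y_n -> p in V, which identifies p as a fixed
   point for f^*. Every fixed point for f^* is a subsolution for f_n, hence at
   most y_n, hence at most p. *)

(** * Hilbert spaces *)

Lemma cvgn_sqr (R : realType) (E : completeNormedModType R)
    (u_ : nat -> E) (a_ : nat -> R) :
  (forall n m, (n <= m)%N -> `|u_ n - u_ m| ^+ 2 <= a_ n) ->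
  a_ n @[n --> \oo] --> 0 -> cvgn u_.
Proof.
move=> ua a0; apply/cauchy_cvgP/cauchy_exP => e e0.
have e20 : 0 < e ^+ 2 by rewrite exprn_gt0.
have /cvgr0_norm_lt/(_ _ e20)[n _ an] := a0.
exists (u_ n), n => //= m nm.
rewrite -ball_normE /ball_/= -(@ltr_pXn2r _ 2) ?nnegrE ?(ltW e0)//.
by rewrite (le_lt_trans (ua _ _ nm))// (le_lt_trans (ler_norm _))// an/=.
Qed.

Lemma cvg_sqr0 (R : realType) (E : normedModType R)
    (u_ : nat -> E) (a_ : nat -> R) :
  (forall n, `|u_ n| ^+ 2 <= a_ n) ->
  a_ n @[n --> \oo] --> 0 -> u_ n @[n --> \oo] --> 0.
Proof.
move=> ua a0; apply/cvgr0Pnorm_lt => e e0.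
have e20 : 0 < e ^+ 2 by rewrite exprn_gt0.
have /cvgr0_norm_lt/(_ _ e20) := a0; apply: filterS => n an.
rewrite -(@ltr_pXn2r _ 2) ?nnegrE ?(ltW e0) //.
by rewrite (le_lt_trans (ua n)) // (le_lt_trans (ler_norm _)).
Qed.

(** The bound makes [b_] non-increasing, so it has a limit [l], and [b_ n - l] controls every later
    squared distance. This serves both decreasing sequences of the cone and least-norm points of
    nested sets. *)
Lemma cvgn_sqr_nonincreasing (R : realType) (E : completeNormedModType R)
    (u_ : nat -> E) (b_ : nat -> R) (L : R) :
  (forall n m, (n <= m)%N -> `|u_ n - u_ m| ^+ 2 <= b_ n - b_ m) ->
  (forall n, L <= b_ n) -> cvgn u_.
Proof.
move=> ub bL.
have bdec : {homo b_ : n m / (n <= m)%N >-> m <= n}.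
  by move=> n m nm; rewrite -subr_ge0 (le_trans _ (ub _ _ nm)) ?sqr_ge0.
have lbb : has_lbound (range b_) by exists L => _ [n _ <-].
have /cvg_ex[l bl] : cvgn b_ by apply: nonincreasing_is_cvgn.
apply: (@cvgn_sqr _ _ _ (fun n => b_ n - l)) => [n m nm|].
  apply: le_trans (ub _ _ nm) _; rewrite lerD2l lerN2.
  by rewrite -(cvg_lim _ bl)//; exact: (nonincreasing_cvgn_ge bdec (cvgP _ bl)).
by rewrite -(subrr l); apply: cvgB => //; exact: cvg_cst.
Qed.

Lemma cvg_dominated (R : realType) (E F : normedModType R) (T : Type)
    (D : set_system T) (FD : Filter D) (B : R)
    (u_ : T -> E) (u : E) (w_ : T -> F) (w : F) : 0 <= B ->
  (forall t, `|w_ t - w| <= B * `|u_ t - u|) ->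
  u_ @ D --> u -> w_ @ D --> w.
Proof.
move=> B0 wu uu; apply/cvgrPdist_lt => e e0.
have B1 : 0 < B + 1 by rewrite ltr_wpDl.
have eB : 0 < e / (B + 1) by rewrite divr_gt0.
have /cvgrPdist_lt/(_ _ eB) := uu; apply: filterS => t.
rewrite ltr_pdivlMr // distrC => ut; rewrite distrC (le_lt_trans (wu t)) //.
by apply: le_lt_trans ut; rewrite mulrC ler_wpM2l ?lerDl.
Qed.

(** A predicate on bare functions, so that it covers elements of the dual, the maps [d x] and their
    negatives without packaging each as a linear map. *)
Definition bounded_form (R : realType) (E : normedModType R) (l : E -> R) :=
  (forall a u v, l (a *: u + v) = a * l u + l v) /\
  exists2 B : R, 0 <= B & forall v, `|l v| <= B * `|v|.

Section BoundedForm.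
Context (R : realType) (E : normedModType R) (l : E -> R).
Hypothesis lform : bounded_form l.

Lemma bounded_form0 : l 0 = 0.
Proof. by have := lform.1 1 0 0; rewrite scale1r addr0; lra. Qed.

Lemma bounded_formD u v : l (u + v) = l u + l v.
Proof. by have := lform.1 1 u v; rewrite scale1r mul1r. Qed.

Lemma bounded_formZ a u : l (a *: u) = a * l u.
Proof. by have := lform.1 a u 0; rewrite !addr0 bounded_form0 addr0. Qed.

Lemma bounded_formN u : l (- u) = - l u.
Proof. by rewrite -scaleN1r bounded_formZ mulN1r. Qed.

Lemma bounded_formB u v : l (u - v) = l u - l v.
Proof. by rewrite bounded_formD bounded_formN. Qed.

Lemma bounded_form_continuous : continuous (l : E -> R^o).
Proof.
have [B B0 lB] := lform.2 => u.
apply: (@cvg_dominated _ _ _ _ _ _ B (fun v : E => v) u) => // v.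
by rewrite -bounded_formB lB.
Qed.

Lemma bounded_form_cvg (u_ : nat -> E) (u : E) :
  u_ n @[n --> \oo] --> u -> l (u_ n) @[n --> \oo] --> l u.
Proof. by move=> uu; apply: continuous_cvg uu; exact: bounded_form_continuous. Qed.

End BoundedForm.

Lemma dual_bounded_form (R : realType) (E : normedModType R) (f : dual E) :
  bounded_form f.
Proof.
split=> [a u v|]; first by rewrite linearP.
have /(continuous_linear_bounded 0)/linear_boundedP :
  {for 0, continuous (dual_lin f)} by exact: dual_continuous.
move=> [M [_ hM]]; exists (`|M| + 1) => [|v]; first by rewrite addr_ge0.
by apply: hM; rewrite (le_lt_trans (ler_norm M)) // ltrDl.
Qed.

Lemma dualN (R : realType) (E : normedModType R) (f : dual E) (v : E) :
  f (- v) = - f v :> R.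
Proof. exact: bounded_formN (dual_bounded_form f) v. Qed.

Definition segment_convex (R : realType) (E : normedModType R) (K : set E) :=
  forall x y (t : R), K x -> K y -> 0 <= t -> t <= 1 -> K ((1 - t) *: x + t *: y).

Lemma first_variation_ge0 (R : realFieldType) (X Y : R) : 0 <= Y ->
  (forall t, 0 < t -> t <= 1 -> 0 <= t * (2 * X) + t ^+ 2 * Y) -> 0 <= X.
Proof.
move=> Y0 XY; rewrite leNgt; apply/negP => X0.
have Z0 : 0 < Y + - X by lra.
(* For [X < 0] this [t] satisfies [t * Y = - X + t * X], hence [2 * X + t * Y = (1 + t) * X < 0]. *)
have t0 : 0 < - X / (Y - X) by rewrite divr_gt0 ?oppr_gt0.
have t1 : - X / (Y - X) <= 1 by rewrite ler_pdivrMr //; lra.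
have := XY _ t0 t1; set t := - X / (Y - X) in t0 t1 *.
have -> : t * (2 * X) + t ^+ 2 * Y = t * (2 * X + t * Y) by ring.
rewrite pmulr_rge0 // => h.
have tE : t * (Y - X) = - X by rewrite /t mulfVK // gt_eqF.
have : t * X < 0 by rewrite pmulr_rlt0.
by nra.
Qed.

(** * Quadratic minimization, projections and the Riesz theorem *)

Section Hilbert.
Context (R : realType) (E : completeNormedModType R) (d : {dot E for idfun}).
Hypothesis dnorm : forall v, d v v = `|v| ^+ 2.

Lemma dotC u v : d u v = d v u.
Proof. by have := @hermC _ false idfun E d u v; rewrite expr0 mul1r. Qed.

Lemma dotPr x a u v : d x (a *: u + v) = a * d x u + d x v.
Proof. by rewrite linearPr. Qed.

Lemma dotDr x u v : d x (u + v) = d x u + d x v.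
Proof. by rewrite linearDr. Qed.

Lemma dotNr x u : d x (- u) = - d x u.
Proof. by rewrite linearNr. Qed.

Lemma dotZr x a u : d x (a *: u) = a * d x u.
Proof. by rewrite linearZr_LR. Qed.

Lemma dotDl x u v : d (u + v) x = d u x + d v x.
Proof. by rewrite !(dotC _ x) dotDr. Qed.

Lemma dotNl x u : d (- u) x = - d u x.
Proof. by rewrite !(dotC _ x) dotNr. Qed.

Lemma dotZl x a u : d (a *: u) x = a * d u x.
Proof. by rewrite !(dotC _ x) dotZr. Qed.

Definition dotE := (dotDr, dotNr, dotZr, dotDl, dotNl, dotZl).

Lemma sqr_normD u v : `|u + v| ^+ 2 = `|u| ^+ 2 + 2 * d u v + `|v| ^+ 2.
Proof. by rewrite -!dnorm !dotE (dotC v u); ring. Qed.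

Lemma sqr_normB u v : `|u - v| ^+ 2 = `|u| ^+ 2 - 2 * d u v + `|v| ^+ 2.
Proof. by rewrite sqr_normD dotNr normrN; ring. Qed.

Lemma cauchy_schwarz u v : `|d u v| <= `|u| * `|v|.
Proof.
have [->|u0] := eqVneq u 0.
  have -> : d 0 v = 0 by rewrite -(scale0r (0 : E)) dotZl mul0r.
  by rewrite !normr0 mul0r.
have nu : 0 < `|u| by rewrite normr_gt0.
rewrite -(@ler_pXn2r _ 2) ?nnegrE ?mulr_ge0// real_normK ?num_real//.
have := sqr_ge0 `| (`|u| ^+ 2) *: v - d u v *: u|.
rewrite -[X in 0 <= X]dnorm !dotE !dnorm (dotC v u) => h.
have : 0 <= `|u| ^+ 2 * (`|u| ^+ 2 * `|v| ^+ 2 - d u v ^+ 2).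
  by apply: le_trans h _; rewrite le_eqVlt; apply/orP; left; apply/eqP; ring.
by rewrite pmulr_rge0 ?exprn_gt0// subr_ge0 exprMn.
Qed.

Lemma bounded_form_dot x : bounded_form (d x).
Proof.
by split; [exact: dotPr | exists `|x| => // v; exact: cauchy_schwarz].
Qed.

Lemma dot_cvg (x_ z_ : nat -> E) (x z : E) :
  x_ n @[n --> \oo] --> x -> z_ n @[n --> \oo] --> z ->
  d (x_ n) (z_ n) @[n --> \oo] --> d x z.
Proof.
have polar u v : d u v = 4^-1 * (`|u + v| * `|u + v| - `|u - v| * `|u - v|).
  by rewrite -!expr2 sqr_normB sqr_normD; field.
move=> xx zz; under eq_fun do rewrite polar; rewrite polar.
apply: cvgM; first exact: cvg_cst.
have cD : `|x_ n + z_ n| @[n --> \oo] --> `|x + z|.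
  by apply: cvg_norm; exact: cvgD.
have cB : `|x_ n - z_ n| @[n --> \oo] --> `|x - z|.
  by apply: cvg_norm; exact: cvgB.
by apply: cvgB; exact: cvgM.
Qed.

(* The solution minimizes [`|v| ^+ 2 - 2 * l v] over [K], and minimizing
   sequences are Cauchy by the parallelogram identity. *)
Lemma hilbert_variational (l : E -> R) (K : set E) : bounded_form l ->
  closed K -> segment_convex K -> K !=set0 ->
  exists2 p, K p & forall v, K v -> 0 <= d p (v - p) - l (v - p).
Proof.
move=> lform Kcl Kcvx [k0 Kk0]; have [B B0 lB] := lform.2.
pose q v := `|v| ^+ 2 - 2 * l v.
have Qinf : has_inf (q @` K).
  split; first by exists (q k0), k0.
  exists (- B ^+ 2) => _ [v _ <-]; rewrite /q.
  have := lB v; rewrite ler_norml => /andP[_ lv].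
  by have := sqr_ge0 (`|v| - B); rewrite sqrrB; lra.
set m := inf (q @` K).
have mq v : K v -> m <= q v by move=> Kv; apply: ge_inf; [exact: Qinf.2|exists v].
have min_seq n : exists v, K v /\ q v < m + harmonic n.
  have [_ [v Kv <-] qv] := inf_adherent (@harmonic_gt0 R n) Qinf.
  by exists v.
have [u_ u_min] := choice min_seq.
have qmid v w : K v -> K w -> `|v - w| ^+ 2 <= 2 * (q v - m) + 2 * (q w - m).
  move=> Kv Kw.
  have half : 1 - 2^-1 = 2^-1 :> R by lra.
  have : m <= q (2^-1 *: (v + w)).
    by apply: mq; rewrite scalerDr -{1}half; apply: Kcvx => //; lra.
  rewrite /q (bounded_formZ lform) (bounded_formD lform) -!dnorm !dotE.
  by rewrite (dotC w v); lra.
have /cvg_ex[p up] : cvgn u_.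
  apply: (@cvgn_sqr _ _ _ (fun n => 4 * harmonic n)) => [n k nk|]; last first.
    by rewrite -(mulr0 4); apply: cvgM; [exact: cvg_cst|exact: cvg_harmonic].
  apply: le_trans (qmid _ _ (u_min n).1 (u_min k).1) _.
  have := (u_min n).2; have := (u_min k).2.
  have : @harmonic R k <= harmonic n.
    by rewrite /harmonic lef_pV2 ?posrE ?ler_nat.
  lra.
have Kp : K p by apply: (closed_cvg _ Kcl _ _ up); apply: nearW => n; exact: (u_min n).1.
have qp v : K v -> q p <= q v.
  move=> Kv; apply: le_trans (mq _ Kv).
  have qup : q (u_ n) @[n --> \oo] --> q p.
    apply: cvgB; first by rewrite expr2; apply: cvgM; exact: cvg_norm.
    by apply: cvgM; [exact: cvg_cst|exact: bounded_form_cvg].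
  have mup : m + harmonic n @[n --> \oo] --> m.
    by rewrite -[X in _ --> X]addr0; apply: cvgD; [exact: cvg_cst|exact: cvg_harmonic].
  apply: (ler_cvg_to qup mup); apply: nearW => n; exact: ltW (u_min n).2.
exists p => // v Kv.
(* The variational inequality is the first-order part in [t] of minimality along the segment from
   [p] to [v]. *)
apply: (@first_variation_ge0 _ _ (`|v - p| ^+ 2)) => [|t t0 t1]; first exact: sqr_ge0.
have := qp _ (Kcvx _ _ t Kp Kv (ltW t0) t1).
have -> : (1 - t) *: p + t *: v = p + t *: (v - p).
  by rewrite scalerBl scale1r scalerBr -addrA (addrC (- _)).
rewrite /q sqr_normD (bounded_formD lform) (bounded_formZ lform) dotZr.
by rewrite normrZ exprMn real_normK ?num_real//; lra.
Qed.

Lemma hilbert_projection (K : set E) (x : E) :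
  closed K -> segment_convex K -> K !=set0 ->
  exists2 p, K p & forall v, K v -> d (x - p) (v - p) <= 0.
Proof.
move=> Kcl Kcvx K0.
have [p Kp hp] := hilbert_variational (bounded_form_dot x) Kcl Kcvx K0.
by exists p => // v /hp; rewrite dotDl dotNl; lra.
Qed.

Lemma riesz (l : E -> R) : bounded_form l -> exists r, forall v, l v = d r v.
Proof.
move=> lform.
have [] // := @hilbert_variational l setT lform closedT.
  by exists 0.
move=> r _ hr; exists r => v; apply/eqP; rewrite -subr_eq0; apply/eqP.
(* Over the whole space both directions [v] and [- v] may be tested, which turns the inequality into
   an equality. *)
have := hr (r + v) I; have := hr (r - v) I.
by rewrite !(addrC r) !addrK dotNr (bounded_formN lform); lra.
Qed.

End Hilbert.

(** * Variational inequalities for strongly monotone Lipschitz maps *)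

Section LionsStampacchia.
Context (R : realType) (E : completeNormedModType R) (d : {dot E for idfun}).
Hypothesis dnorm : forall v, d v v = `|v| ^+ 2.

(** A solution is a fixed point of [y |-> P (y - rho *: (a y - g))], with [P] the projection onto
    [K]. For a suitable [rho] this map is a contraction, by strong monotonicity and the Lipschitz
    bound. *)
Lemma lions_stampacchia (a : E -> E) (L c : R) (K : set E) (g : E) : 0 < c ->
  (forall u v, `|a u - a v| <= L * `|u - v|) ->
  (forall u v, c * `|u - v| ^+ 2 <= d (a u - a v) (u - v)) ->
  closed K -> segment_convex K -> K !=set0 ->
  exists2 y, K y & forall v, K v -> 0 <= d (a y - g) (v - y).
Proof.
move=> c0 alip amon Kcl Kcvx K0.
(* Adding [c] makes [M] a positive Lipschitz constant with [c <= M]. Then [rho = c / M ^+ 2] gives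
   [rho * c <= 1] and the squared contraction factor [1 - 2 * rho * c + rho ^+ 2 * M ^+ 2 = 1 - rho
   * c]. *)
pose M := `|L| + c; have M0 : 0 < M by rewrite ltr_wpDl.
pose rho := c / M ^+ 2; have rho0 : 0 < rho by rewrite divr_gt0 ?exprn_gt0.
pose q := Num.sqrt (1 - rho * c).
have rM : rho * M ^+ 2 = c by rewrite mulfVK // gt_eqF ?exprn_gt0.
have rc1 : 0 <= 1 - rho * c.
  have cM : c <= M by rewrite lerDr.
  have -> : rho * c = (rho * M) ^+ 2 by rewrite exprMn expr2 -mulrA rM.
  rewrite subr_ge0.
  have rM1 : rho * M <= 1.
    by rewrite -(@ler_pM2r _ M) // mul1r -mulrA -expr2 rM.
  by rewrite exprn_ile1 // mulr_ge0 // ltW.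
have proj x : exists p, K p /\ forall v, K v -> d (x - p) (v - p) <= 0.
  by have [p] := hilbert_projection dnorm x Kcl Kcvx K0; exists p.
have [P PP] := choice proj.
have Plip x z : `|P x - P z| <= `|x - z|.
  have := (PP x).2 _ (PP z).1; have := (PP z).2 _ (PP x).1.
  move=> h1 h2.
  have : `|P x - P z| ^+ 2 <= d (x - z) (P x - P z).
    by rewrite -dnorm; move: h1 h2; rewrite !dotE; lra.
  move=> h; have := le_trans (ler_norm _) (cauchy_schwarz dnorm (x - z) (P x - P z)).
  move=> /(le_trans h); have [->//|nz] := eqVneq (`|P x - P z|) 0.
  by rewrite expr2 ler_pM2r // lt_def nz /=.
pose T := totalfun (fun y => P (y - rho *: (a y - g))).
have Tlip y z : `|T y - T z| <= q * `|y - z|.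
  apply: le_trans (Plip _ _) _.
  have -> : y - rho *: (a y - g) - (z - rho *: (a z - g)) =
            (y - z) - rho *: (a y - a z).
    have -> : rho *: (a y - a z) = rho *: (a y - g) - rho *: (a z - g).
      by rewrite -scalerBr opprB addrA subrK.
    by rewrite !opprB [X in _ + X = _]addrC addrACA [X in _ + X = _]addrC.
  rewrite -(@ler_pXn2r _ 2) ?nnegrE ?mulr_ge0 ?sqrtr_ge0 //.
  rewrite exprMn sqr_sqrtr // (sqr_normB dnorm) dotZr (dotC d (y - z)) normrZ exprMn.
  rewrite (gtr0_norm rho0).
  have := amon y z; set D := d _ _ => hD.
  have : `|a y - a z| ^+ 2 <= M ^+ 2 * `|y - z| ^+ 2.
    rewrite -exprMn ler_pXn2r ?nnegrE ?mulr_ge0 ?(ltW M0) //.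
    apply: le_trans (alip y z) _; rewrite ler_wpM2r //.
    by rewrite (le_trans (ler_norm L)) // lerDl ltW.
  rewrite -(@ler_pM2l _ (rho ^+ 2)) ?exprn_gt0 // => h.
  have h2 : rho * (c * `|y - z| ^+ 2) <= rho * D by rewrite ler_pM2l.
  have h3 : rho ^+ 2 * (M ^+ 2 * `|y - z| ^+ 2) = rho * (c * `|y - z| ^+ 2).
    by rewrite -rM; ring.
  by rewrite h3 in h; lra.
have ctr : is_contraction [fun of T].
  exists (NngNum (sqrtr_ge0 (1 - rho * c))); split => /=; last first.
    by move=> [y z] _; exact: Tlip.
  by rewrite -[ltRHS]sqrtr1 ltr_sqrt // gtrBl mulr_gt0.
have [y _ yT] := banach_fixed_point ctr closedT (ex_intro _ 0 I).
have yE : y = P (y - rho *: (a y - g)) by [].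
exists y => [|v Kv]; first by rewrite yE; exact: (PP _).1.
have := (PP (y - rho *: (a y - g))).2 _ Kv; rewrite -yE.
by rewrite addrAC subrr add0r dotNl dotZl oppr_le0 pmulr_rge0.
Qed.

End LionsStampacchia.

(** * Weak limits through nested convex sets *)

Section WeakConvergence.
Context (R : realType) (E F : completeNormedModType R) (d : {dot E for idfun}).
Hypothesis dnorm : forall v, d v v = `|v| ^+ 2.

(** A substitute for weak compactness of balls: the points [p_ n] of least norm in [K_ n] have
    non-decreasing bounded norms, and the increments of the squared norms dominate their squared
    distances, so they converge strongly to a common point. *)
Lemma nested_convex_meet (K_ : nat -> set E) (B : R) :
  (forall n, closed (K_ n)) -> (forall n, segment_convex (K_ n)) ->
  (forall n, exists2 v, K_ n v & `|v| <= B) ->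
  (forall n m, (n <= m)%N -> K_ m `<=` K_ n) -> exists p, forall n, K_ n p.
Proof.
move=> Kcl Kcvx KB Kdec.
have proj n : exists p, K_ n p /\ forall v, K_ n v -> `|p| ^+ 2 <= d p v.
  have K0 : K_ n !=set0 by have [v Kv _] := KB n; exists v.
  have [p Kp hp] := hilbert_projection dnorm 0 (Kcl n) (Kcvx n) K0.
  by exists p; split => // v /hp; rewrite sub0r dotNl dotDr dotNr dnorm; lra.
have [p_ hp] := choice proj.
have /cvg_ex[p pp] : cvgn p_.
  apply: (@cvgn_sqr_nonincreasing _ _ _ (fun n => - `|p_ n| ^+ 2) (- B ^+ 2)).
    move=> n m nm; have := (hp n).2 _ (Kdec _ _ nm _ (hp m).1).
    by rewrite (sqr_normB dnorm); lra.
  move=> n; have [v Kv vB] := KB n; rewrite lerN2.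
  have := le_trans ((hp n).2 _ Kv) (le_trans (ler_norm _) (cauchy_schwarz dnorm _ _)).
  have : `|v| ^+ 2 <= B ^+ 2 by rewrite ler_pXn2r ?nnegrE ?(le_trans _ vB).
  by have := sqr_ge0 (`|p_ n| - `|v|); rewrite sqrrB; lra.
exists p => n; apply: (closed_cvg (K_ n) (Kcl n) _ _ pp).
by exists n => // m nm; exact: Kdec (hp m).1.
Qed.

Context (T : {linear E -> F}).
Hypothesis Tcont : continuous T.

(** The points [v] with [T v] within [harmonic n] of [h] and with [a <= l v] form nested closed
    convex sets that all meet one ball; a point common to them has image exactly [h]. *)
Lemma weak_cluster (l : E -> R) (h : F) (B a : R) : bounded_form l ->
  (forall e, 0 < e -> exists v, [/\ `|v| <= B, `|T v - h| <= e & a <= l v]) ->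
  exists2 p, T p = h & a <= l p.
Proof.
move=> lform happrox.
pose K n := [set v | `|T v - h| <= harmonic n] `&` [set v | a <= l v].
have Kcl n : closed (K n).
  apply: closedI.
    apply: (@closed_comp _ _ (fun v => `|T v - h|) [set x | x <= harmonic n]).
      move=> v _; apply: cvg_norm; apply: cvgB; [exact: Tcont|exact: cvg_cst].
    exact: closed_le.
  apply: (@closed_comp _ _ (l : E -> R^o) [set x | a <= x]); last exact: closed_ge.
  by move=> v _; exact: bounded_form_continuous.
have Kcvx n : segment_convex (K n).
  move=> x y t [/= Tx lx] [/= Ty ly] t0 t1.
  have s0 : 0 <= 1 - t by rewrite subr_ge0.
  have tE (r : R) : r = (1 - t) * r + t * r by ring.
  split => /=.
    have -> : T ((1 - t) *: x + t *: y) - h = (1 - t) *: (T x - h) + t *: (T y - h).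
      rewrite linearD !linearZ !scalerBr addrACA -opprD -scalerDl.
      by rewrite subrK scale1r.
    apply: le_trans (ler_normD _ _) _; rewrite !normrZ !ger0_norm //.
    by rewrite [leRHS]tE; apply: lerD; exact: ler_wpM2l.
  rewrite (bounded_formD lform) !(bounded_formZ lform).
  by rewrite [leLHS]tE; apply: lerD; exact: ler_wpM2l.
have Kne n : exists2 v, K n v & `|v| <= B.
  by have [v [vB vh lv]] := happrox _ (@harmonic_gt0 R n); exists v.
have Kdec n m : (n <= m)%N -> K m `<=` K n.
  move=> nm v [/= vh lv]; split => //=; apply: le_trans vh _.
  by rewrite /harmonic lef_pV2 ?posrE ?ler_nat.
have [p Kp] := nested_convex_meet Kcl Kcvx Kne Kdec.
exists p; last exact: (Kp 0%N).2.
apply/eqP; rewrite -subr_eq0 -normr_le0.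
apply: (ler_cvg_to (cvg_cst `|T p - h|) cvg_harmonic).
by apply: nearW => n; exact: (Kp n).1.
Qed.

(** The zero form with [a = 0] makes the condition on [l] in [weak_cluster] trivial. *)
Lemma bounded_cvg_range (v_ : nat -> E) (h : F) (B : R) :
  (forall n, `|v_ n| <= B) -> T (v_ n) @[n --> \oo] --> h -> exists p, T p = h.
Proof.
move=> vB Th; have [||p] := @weak_cluster (fun=> 0) h B 0; last by exists p.
  by split=> [a u v|]; [rewrite /= mulr0 addr0|exists 0 => //= v; rewrite normr0 mul0r].
move=> e e0; have /cvgrPdist_le/(_ _ e0)[n _ hn] := Th.
by exists (v_ n); split => //; rewrite distrC; exact: (hn n (leqnn n)).
Qed.

Hypothesis Tinj : injective T.

(** If [l (v_ n) >= l p + e] held infinitely often, [weak_cluster] on those terms would give [q]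
    with [T q = T p] and [l q >= l p + e], while injectivity forces [q = p]. The same argument for
    [- l] gives the lower estimate. *)
Lemma bounded_cvg_weak (v_ : nat -> E) (p : E) (B : R) (l : E -> R) :
  bounded_form l -> (forall n, `|v_ n| <= B) ->
  T (v_ n) @[n --> \oo] --> T p -> l (v_ n) @[n --> \oo] --> l p.
Proof.
move=> lform vB Tp.
have half k : bounded_form k -> forall e, 0 < e -> \forall n \near \oo, k (v_ n) < k p + e.
  move=> kform e e0; apply: contrapT => far.
  suff [q /Tinj ->] : exists2 q, T q = T p & k p + e <= k q by lra.
  apply: (@weak_cluster _ _ B) => // r r0.
  have /cvgrPdist_le/(_ _ r0)[N _ hN] := Tp.
  apply: contrapT => hno; apply: far; exists N => // n /= Nn.
  rewrite ltNge; apply/negP => kn; apply: hno.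
  by exists (v_ n); split => //; rewrite distrC; exact: hN.
have Nform : bounded_form (fun v => - l v).
  have [B' B'0 lB] := lform.2; split=> [a u v|].
    by rewrite lform.1; ring.
  by exists B' => // v; rewrite normrN.
apply/cvgrPdist_lt => e e0; near=> n.
rewrite distrC ltr_norml ltrBlDl ltrBrDl; apply/andP; split.
  rewrite -ltrN2 opprD opprK; near: n; exact: half Nform _ e0.
by near: n; exact: half lform _ e0.
Unshelve. all: by end_near. Qed.

End WeakConvergence.

(** * The order of a self-dual lattice cone *)

Section Cone.
Context (R : realType) (V H : completeNormedModType R)
  (G : gelfand_triple V H) (C : set H).
Hypothesis hC : order_cone G C.
Local Notation dH := (dotH G).
Local Notation dHnorm := (dotH_norm G).

Lemma cone_memP x : C x <-> forall y, C y -> 0 <= dH x y.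
Proof. by rewrite {1}(ordc_selfdual hC). Qed.

Lemma cone_dot_ge0 x y : C x -> C y -> 0 <= dH x y.
Proof. by move=> /cone_memP; exact. Qed.

Lemma cone0 : C 0.
Proof.
by apply/cone_memP => y _; rewrite -(scale0r (0 : H)) dotZl mul0r.
Qed.

Lemma coneD x y : C x -> C y -> C (x + y).
Proof.
by move=> Cx Cy; have := ordc_convex hC Cx Cy ler01 ler01; rewrite !scale1r.
Qed.

Lemma cone_segment_convex : segment_convex C.
Proof.
by move=> x y t Cx Cy t0 t1; apply: (ordc_convex hC) => //; rewrite subr_ge0.
Qed.

Lemma hle0 x : hle C 0 x <-> C x.
Proof. by rewrite /hle subr0. Qed.

Lemma hle_refl x : hle C x x.
Proof. by rewrite /hle subrr; exact: cone0. Qed.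

Lemma hle_trans y x z : hle C x y -> hle C y z -> hle C x z.
Proof. by rewrite /hle => /coneD h/h; rewrite addrC subrKA. Qed.

Lemma hle_cone x y : C x -> hle C x y -> C y.
Proof. by move=> /hle0 /hle_trans h /h/hle0. Qed.

Lemma hle_anti x y : hle C x y -> hle C y x -> x = y.
Proof.
rewrite /hle => /cone_dot_ge0 h /h; rewrite -opprB dotNl dHnorm.
rewrite oppr_ge0 => yx.
have : `|x - y| ^+ 2 == 0 by rewrite eq_le yx sqr_ge0.
by rewrite expf_eq0 /= normr_eq0 subr_eq0 => /eqP.
Qed.

Lemma hle_lim (x_ y_ : nat -> H) x y : (\forall n \near \oo, hle C (x_ n) (y_ n)) ->
  x_ n @[n --> \oo] --> x -> y_ n @[n --> \oo] --> y -> hle C x y.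
Proof.
move=> xy xx yy; apply: (closed_cvg C (ordc_closed hC) _ _ (cvgB yy xx)).
exact: xy.
Qed.

(** In the expansion of the squared norm of [y = x + (y - x)], the cross term is non-negative
    because both summands lie in the cone. *)
Lemma hle_sqr_norm x y : C x -> hle C x y -> `|y - x| ^+ 2 <= `|y| ^+ 2 - `|x| ^+ 2.
Proof.
move=> Cx xy; have := cone_dot_ge0 Cx xy.
by rewrite dotDr dotNr dHnorm (sqr_normB dHnorm) (dotC dH y x); lra.
Qed.

Lemma hle_norm x y : C x -> hle C x y -> `|x| <= `|y|.
Proof.
move=> Cx xy; rewrite -(@ler_pXn2r _ 2) ?nnegrE // -subr_ge0.
by rewrite (le_trans _ (hle_sqr_norm Cx xy)) ?sqr_ge0.
Qed.

(** The point [p] given by the variational inequality satisfies the Pythagorean estimate [pmin], so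
    it is the only nearest point of the cone and [xget] returns it. *)
Lemma posP x : C (pos C x) /\ forall z, C z -> dH (x - pos C x) (z - pos C x) <= 0.
Proof.
have [p Cp px] := hilbert_projection dHnorm x (ordc_closed hC) cone_segment_convex
  (ex_intro _ 0 cone0).
have pmin z : C z -> `|x - p| ^+ 2 + `|z - p| ^+ 2 <= `|x - z| ^+ 2.
  move=> Cz; have -> : x - z = (x - p) - (z - p) by rewrite opprB addrA subrK.
  by rewrite (sqr_normB dHnorm (x - p)); have := px _ Cz; lra.
suff -> : pos C x = p by [].
apply: xget_unique => [|z [Cz zx]].
  split => // z Cz; rewrite -(@ler_pXn2r _ 2) ?nnegrE //.
  by apply: le_trans (pmin z Cz); rewrite lerDl sqr_ge0.
have := zx _ Cp; rewrite -(@ler_pXn2r _ 2) ?nnegrE // => zp.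
have : `|z - p| ^+ 2 == 0 by rewrite eq_le sqr_ge0 andbT; have := pmin z Cz; lra.
by rewrite expf_eq0 /= normr_eq0 subr_eq0 => /eqP.
Qed.

Lemma pos_cone x : C (pos C x).
Proof. by case: (posP x). Qed.

(** Testing the projection inequality with [pos C x + z] shows that [pos C x - x] has a non-negative
    product with every [z] of the cone; self-duality concludes. *)
Lemma hle_pos x : hle C x (pos C x).
Proof.
apply/cone_memP => z Cz; have := (posP x).2 _ (coneD (pos_cone x) Cz).
by rewrite addrAC subrr add0r -opprB dotNl oppr_le0.
Qed.

Lemma pos_id x : C x -> pos C x = x.
Proof.
move=> Cx; have := (posP x).2 _ Cx; rewrite dHnorm => h.
have : `|x - pos C x| ^+ 2 == 0 by rewrite eq_le h sqr_ge0.
by rewrite expf_eq0 /= normr_eq0 subr_eq0 => /eqP.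
Qed.

Lemma pos_eq0 x : pos C x = 0 -> hle C x 0.
Proof. by move=> x0; rewrite -x0; exact: hle_pos. Qed.

Lemma hle_sub0 x y : hle C (x - y) 0 -> hle C x y.
Proof. by rewrite /hle sub0r opprB. Qed.

Lemma hsup_gel x y : hle C x (hsup C x y).
Proof. by rewrite /hle /hsup addrAC subrr add0r; exact: pos_cone. Qed.

Lemma hsup_ger x y : hle C y (hsup C x y).
Proof.
by rewrite /hle /hsup addrAC addrC -[x - y]opprB; exact: hle_pos.
Qed.

Lemma nonincreasing_cone_cvg (z_ : nat -> H) : (forall n, C (z_ n)) ->
  (forall n, hle C (z_ n.+1) (z_ n)) ->
  exists z, [/\ z_ n @[n --> \oo] --> z, C z & forall n, hle C z (z_ n)].
Proof.
move=> Cz zdec.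
have zmono n m : (n <= m)%N -> hle C (z_ m) (z_ n).
  elim: m => [|m IH]; first by rewrite leqn0 => /eqP ->; exact: hle_refl.
  rewrite leq_eqVlt => /orP[/eqP ->|/IH]; first exact: hle_refl.
  exact: hle_trans.
have /cvg_ex[z zz] : cvgn z_.
  apply: (@cvgn_sqr_nonincreasing _ _ _ (fun n => `|z_ n| ^+ 2) 0) => [n m nm|n].
    by apply: hle_sqr_norm => //; exact: zmono.
  exact: sqr_ge0.
exists z; split=> // [|n].
  by apply: (closed_cvg C (ordc_closed hC) _ _ zz); exact: nearW.
apply: (@hle_lim z_ (cst (z_ n))) zz (cvg_cst _).
by exists n => // m /=; exact: zmono.
Qed.

(* Order completeness: norms are monotone on the cone, so a sequence in [D]
   whose norms approach their supremum is Cauchy. *)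
Lemma directed_lub (D : set H) (b : H) : D !=set0 ->
  (forall x, D x -> C x /\ hle C x b) ->
  (forall x y, D x -> D y -> D (hsup C x y)) ->
  exists m, [/\ C m, forall x, D x -> hle C x m &
    forall u, (forall x, D x -> hle C x u) -> hle C m u].
Proof.
move=> [x0 Dx0] DCb Dsup.
pose N := [set `|x| ^+ 2 | x in D].
have Nsup : has_sup N.
  split; first by exists (`|x0| ^+ 2), x0.
  exists (`|b| ^+ 2) => _ [x /DCb[Cx xb] <-].
  by rewrite ler_pXn2r ?nnegrE // hle_norm.
have seq n : exists x, D x /\ sup N - harmonic n < `|x| ^+ 2.
  by have [_ [x Dx <-] hx] := sup_adherent (@harmonic_gt0 R n) Nsup; exists x.
have [x_ hx] := choice seq.
(* The join stays in [D], so its squared norm is at most [sup N], which that of [x_ n] nearly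
   attains. *)
have close n x : D x -> `|hsup C (x_ n) x - x_ n| ^+ 2 <= harmonic n.
  move=> Dx; have [Dn hn] := hx n; have Dw := Dsup _ _ Dn Dx.
  apply: le_trans (hle_sqr_norm (DCb _ Dn).1 (hsup_gel _ _)) _.
  have : `|hsup C (x_ n) x| ^+ 2 <= sup N.
    by apply: (ub_le_sup Nsup.2); exists (hsup C (x_ n) x).
  by lra.
have hsupC x y : hsup C x y = hsup C y x.
  by apply: hle_anti; apply: (ordc_sup hC); (exact: hsup_gel || exact: hsup_ger).
have /cvg_ex[m xm] : cvgn x_.
  apply: (@cvgn_sqr _ _ _ (fun n => 4 * harmonic n)) => [n k nk|]; last first.
    by rewrite -(mulr0 4); apply: cvgM; [exact: cvg_cst|exact: cvg_harmonic].
  have kn : @harmonic R k <= harmonic n.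
    by rewrite /harmonic lef_pV2 ?posrE ?ler_nat.
  have h1 := close n _ (hx k).1; have h2 := close k _ (hx n).1.
  rewrite hsupC in h2; set w := hsup _ _ _ in h1 h2.
  (* By the parallelogram law, two points close to their common join [w] are close to each other. *)
  have -> : x_ n - x_ k = (w - x_ k) - (w - x_ n).
    by rewrite opprB [RHS]addrC subrKA.
  have := sqr_ge0 `|(w - x_ k) + (w - x_ n)|.
  rewrite (sqr_normB dHnorm (w - x_ k)) (sqr_normD dHnorm (w - x_ k)).
  by lra.
exists m; split=> [|x Dx|u Du].
- apply: (closed_cvg C (ordc_closed hC) _ _ xm); apply: nearW => n.
  by case: (DCb _ (hx n).1).
(* The join of [x_ n] and [x] differs from [x_ n] by a null sequence, so it also tends to [m] while
   staying above [x]. *)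
- have wm : hsup C (x_ n) x @[n --> \oo] --> m.
    rewrite -[m]add0r.
    under eq_fun => n do rewrite -[hsup C (x_ n) x](subrK (x_ n)).
    apply: cvgD => //; apply: cvg_sqr0 cvg_harmonic => n; exact: close.
  apply: (@hle_lim (cst x) _ _ _ _ (cvg_cst _) wm).
  by apply: nearW => n; exact: hsup_ger.
- apply: (@hle_lim x_ (cst u)) xm (cvg_cst _).
  by apply: nearW => n; exact: Du (hx n).1.
Qed.

(** Tarski's argument: [m] is the least upper bound of the set [D] of subsolutions, which contains
    [0] and is closed under joins by monotonicity. Then [T m] bounds [D] from above, so [m] is below
    [T m], and [T m] itself lies in [D]. *)
Lemma monotone_largest_fixpoint (T : H -> H) (b : H) : C b ->
  (forall x, C x -> hle C x b -> C (T x) /\ hle C (T x) b) ->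
  (forall x y, C x -> hle C x y -> hle C y b -> hle C (T x) (T y)) ->
  exists m, [/\ C m, hle C m b, T m = m &
    forall x, C x -> hle C x b -> hle C x (T x) -> hle C x m].
Proof.
move=> Cb Tb Tmono.
pose D := [set x | [/\ C x, hle C x b & hle C x (T x)]].
have D0 : D 0 by split; [exact: cone0| exact/hle0 |
  apply/hle0; apply: (Tb _ cone0 _).1; exact/hle0].
have Dsup x y : D x -> D y -> D (hsup C x y).
  move=> [Cx xb xT] [Cy yb yT].
  have sb : hle C (hsup C x y) b by exact: (ordc_sup hC).
  split=> //; first exact: hle_cone (hsup_gel x y).
  apply: (ordc_sup hC).
    by apply: hle_trans xT _; apply: Tmono => //; exact: hsup_gel.
  by apply: hle_trans yT _; apply: Tmono => //; exact: hsup_ger.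
have DCb x : D x -> C x /\ hle C x b by case.
have [m [Cm Dm mlub]] := directed_lub (ex_intro _ _ D0) DCb Dsup.
have mb : hle C m b by apply: mlub => x [].
have mT : hle C m (T m).
  apply: mlub => x Dx; have [Cx xb xT] := Dx.
  by apply: hle_trans xT _; apply: Tmono => //; exact: Dm.
have [CT Tmb] := Tb m Cm mb.
exists m; split=> // [|x Cx xb xT]; last exact: Dm.
by apply: hle_anti => //; apply: Dm; split=> //; exact: Tmono.
Qed.

End Cone.

(** * The obstacle problem *)

Section Obstacle.
Context (R : realType) (V H : completeNormedModType R)
  (G : gelfand_triple V H) (C : set H) (A : V -> dual V).
Hypothesis hC : order_cone G C.
Hypothesis hA : operator G C A.

(** The supremum is over a set bounded by Cauchy-Schwarz, and for nonzero [r] it is at least the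
    value at the unit vector along [r]. *)
Lemma le_dual_norm (r : V) : `|r| <= dual_norm (dotV G r).
Proof.
have hdr := cauchy_schwarz (dotV_norm G) r.
have ub : has_ubound [set `|dotV G r v| | v in [set v | `|v| <= 1]].
  exists `|r| => _ [v /= v1 <-]; apply: le_trans (hdr v) _.
  by rewrite -[leRHS]mulr1 ler_wpM2l.
have [r0|r0] := eqVneq r 0.
  rewrite r0 normr0 -r0; apply: le_trans (ub_le_sup ub _); last first.
    by exists 0 => //=; rewrite normr0.
  exact: normr_ge0.
have nr0 : 0 < `|r| by rewrite normr_gt0.
apply: (ub_le_sup ub); exists (`|r|^-1 *: r) => /=.
  by rewrite normrZ normfV normr_id mulVf // gt_eqF.
rewrite dotZr dotV_norm expr2 mulKf ?gt_eqF //.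
by rewrite normr_id.
Qed.

(** Riesz representatives turn [A] into a Lipschitz map of [V] into itself, the form to which
    [lions_stampacchia] applies. *)
Lemma operator_riesz : exists2 a : V -> V, forall u v, A u v = dotV G (a u) v &
  exists L : R, forall u v, `|a u - a v| <= L * `|u - v|.
Proof.
have [a ha] : exists a, forall u v, A u v = dotV G (a u) v.
  have hr u := riesz (dotV_norm G) (dual_bounded_form (A u)).
  by have [a ha] := choice hr; exists a.
have [L hL] := opm_lipschitz hA; exists a => //; exists L => u v.
apply: le_trans (le_dual_norm _) (le_trans _ (hL u v)).
by under [in leRHS]eq_fun do rewrite !ha -dotNl -dotDl.
Qed.

(** Homogeneity with [t = 2] gives [A 0 v = 2 * A 0 v]. *)
Lemma operator0 v : A 0 v = 0.
Proof. by have := opm_homogeneous hA 0 v (ltr0Sn R 1); rewrite scaler0; lra. Qed.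

(** For [w] the positive part of [y1 - y2], the assumed inequality and T-monotonicity force the
    equality case, hence [w = 0]. *)
Lemma T_monotone_hle y1 y2 : (forall w, emb G w = pos C (emb G (y1 - y2)) ->
  A y1 w <= A y2 w) -> hle C (emb G y1) (emb G y2).
Proof.
move=> hw; have [K _ /(_ (y1 - y2))[w wE _]] := ordc_posV hC.
have [Aw0 Aw] := opm_Tmonotone hA wE; have := hw w wE.
rewrite -subr_le0 => Aw1; have /Aw w0 : A y1 w - A y2 w = 0.
  by apply/eqP; rewrite eq_le Aw0 Aw1.
apply: (@hle_sub0 _ H); rewrite -linearB.
by apply: (pos_eq0 hC); rewrite -wE w0 linear0.
Qed.

(** The test elements are [y1 - w], the infimum of [y1] and [y2], admissible for [psi1], and
    [y2 + w], their supremum, admissible for [psi2] by [ordc_sup]. They give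
    [A y1 w <= f1 w <= f2 w <= A y2 w]. *)
Lemma obstacle_comparison (f1 f2 : dual V) psi1 psi2 y1 y2 :
  dle G C f1 f2 -> hle C psi1 psi2 ->
  is_obstacle_solution G C A f1 psi1 y1 ->
  is_obstacle_solution G C A f2 psi2 y2 -> hle C (emb G y1) (emb G y2).
Proof.
move=> f12 psi12 [Ky1 hy1] [Ky2 hy2]; apply: T_monotone_hle => w wE.
have f12w : 0 <= f2 w - f1 w.
  by apply: f12; rewrite wE; apply/hle0; exact: (pos_cone hC).
have := hy1 (y1 - w); have := hy2 (y2 + w).
rewrite !(addrC _ w) (addrC y1 (- w)) !addrK !dualN => h2 h1.
have {}h2 : 0 <= A y2 w - f2 w.
  apply: h2; rewrite /obstacle_set/= addrC linearD wE linearB.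
  by apply: (ordc_sup hC) => //; exact: (hle_trans hC) psi12.
have {}h1 : 0 <= - A y1 w - - f1 w.
  apply: h1; rewrite /obstacle_set/= addrC linearB wE.
  apply: (hle_trans hC) Ky1; rewrite /hle opprB addrC subrK.
  exact: (pos_cone hC).
lra.
Qed.

Lemma obstacle_solution_unique (f : dual V) psi y1 y2 :
  is_obstacle_solution G C A f psi y1 ->
  is_obstacle_solution G C A f psi y2 -> y1 = y2.
Proof.
move=> h1 h2; apply: (@emb_injective _ _ _ G); apply: (hle_anti hC).
  apply: obstacle_comparison h1 h2; last exact: (hle_refl hC).
  by move=> v _; rewrite subrr.
apply: obstacle_comparison h2 h1; last exact: (hle_refl hC).
by move=> v _; rewrite subrr.
Qed.

Lemma obstacle_solutionP (f : dual V) psi : C psi ->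
  is_obstacle_solution G C A f psi (obstacle_solution G C A f psi).
Proof.
move=> Cpsi; apply: xgetPex.
have [a ha [L alip]] := operator_riesz.
have [g hg] := riesz (dotV_norm G) (dual_bounded_form f).
have [c c0 amon] := opm_strongly_monotone hA.
have [||||y Ky hy] := @lions_stampacchia _ _ _ (dotV_norm G) a L c
    (obstacle_set G C psi) g c0 alip.
- by move=> u v; rewrite dotDl dotNl -!ha; exact: amon.
- apply: (@closed_comp _ _ (fun v => psi - emb G v) C); last exact: ordc_closed hC.
  by move=> v _; apply: cvgB; [exact: cvg_cst|exact: emb_continuous].
- move=> x y t Kx Ky t0 t1; rewrite /obstacle_set /= /hle.
  have -> : psi - emb G ((1 - t) *: x + t *: y) =
      (1 - t) *: (psi - emb G x) + t *: (psi - emb G y).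
    rewrite linearD !linearZ !scalerBr addrACA -opprD -scalerDl.
    by rewrite subrK scale1r.
  exact: (cone_segment_convex hC).
- by exists 0; rewrite /obstacle_set /= /hle linear0 subr0.
exists y; split => // v /hy; rewrite dotDl dotNl -ha -hg.
exact.
Qed.

(** Since [A 0 = 0], the element [0] solves the problem with zero force and zero obstacle, and
    comparison applies. *)
Lemma obstacle_solution_ge0 (f : dual V) psi y : dle G C (fun=> 0) f -> C psi ->
  is_obstacle_solution G C A f psi y -> C (emb G y).
Proof.
move=> f0 Cpsi ysol; apply/hle0; rewrite -(linear0 (emb G)).
apply: (@obstacle_comparison (to_dual G 0) f 0 psi 0 y) ysol => //.
- move=> v hv; suff -> : to_dual G 0 v = 0 by exact: f0.
  by rewrite /= /to_dual_fun -(scale0r (0 : H)) dotZl mul0r.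
- exact/hle0.
- split; first by rewrite /obstacle_set /= linear0; exact: (hle_refl hC).
  move=> v _; rewrite operator0 subr0 sub0r /= /to_dual_fun.
  by rewrite -(scale0r (0 : H)) dotZl mul0r oppr0.
Qed.

(** Since [ybar] solves an equation, the single test element [y - w] suffices:
    [A y w <= f w <= F w = A ybar w]. *)
Lemma obstacle_solution_le (f F : dual V) psi y ybar : dle G C f F ->
  (forall v, A ybar v = F v) -> is_obstacle_solution G C A f psi y ->
  hle C (emb G y) (emb G ybar).
Proof.
move=> fF hybar [Ky hy]; apply: T_monotone_hle => w wE.
have fFw : 0 <= F w - f w.
  by apply: fF; rewrite wE; apply/hle0; exact: (pos_cone hC).
have := hy (y - w); rewrite (addrC y) addrK !dualN hybar => h.
have {}h : 0 <= - A y w - - f w.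
  apply: h; rewrite /obstacle_set/= addrC linearB wE.
  apply: (hle_trans hC) Ky; rewrite /hle opprB addrC subrK.
  exact: (pos_cone hC).
lra.
Qed.

(** Testing with [0] bounds [A y y] by the pairing of [f] with [y]; strong monotonicity bounds it
    from below, and the norm of [y] in [H] is at most that of [b]. *)
Lemma obstacle_solution_bound (f psi : H) y b (c : R) : 0 < c ->
  (forall u v, c * `|u - v| ^+ 2 <= A u (u - v) - A v (u - v)) ->
  C psi -> C (emb G y) -> hle C (emb G y) b ->
  is_obstacle_solution G C A (to_dual G f) psi y ->
  `|y| <= `|f| * `|b| / c + 1.
Proof.
move=> c0 amon Cpsi Cy yb [_ /(_ 0)].
have K0 : obstacle_set G C psi 0 by rewrite /obstacle_set /= linear0; apply/hle0.
move=> /(_ K0); rewrite sub0r !dualN => h.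
have := amon y 0; rewrite subr0 operator0 subr0 => hy.
have fy : to_dual G f y <= `|f| * `|b|.
  apply: le_trans (ler_norm _) (le_trans (cauchy_schwarz (dotH_norm G) _ _) _).
  by rewrite ler_wpM2l // (hle_norm hC).
have : `|y| ^+ 2 <= `|f| * `|b| / c by rewrite ler_pdivlMr // mulrC; lra.
(* The [+ 1] in the bound avoids a square root: [t ^+ 2 <= s] implies [t <= s + 1]. *)
have := normr_ge0 y; nra.
Qed.

(** * The largest fixed point of the obstacle map *)

Context (Phi : H -> H).
Hypothesis hPhi : increasing_on_cone C Phi.

Lemma ext_cone x : C (ext C Phi x).
Proof. by apply: hPhi.1; exact: (pos_cone hC). Qed.

Lemma ext_hle x y : C x -> hle C x y -> hle C (ext C Phi x) (ext C Phi y).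
Proof.
move=> Cx xy; rewrite /ext !(pos_id hC) //; last exact: (hle_cone hC) Cx xy.
by apply: hPhi.2 => //; exact/hle0.
Qed.

Lemma max_solution_largest (ybar : V) (f : dual V) m :
  is_largest G C (fixed_points G C A Phi ybar f) m ->
  max_solution G C A Phi ybar f = m.
Proof.
move=> [Fm hm]; apply: xget_unique => // n [Fn hn].
by apply: (@emb_injective _ _ _ G); apply: (hle_anti hC); [exact: hm|exact: hn].
Qed.

(** The fixed point [h] is found in [H] and lifted to [V] as [S h]. Maximality among all
    subsolutions, not only fixed points, is what allows solutions for different forces to be
    compared. *)
Lemma max_solution_spec (F f : dual V) (ybar : V) :
  (forall v, A ybar v = F v) -> dle G C (fun=> 0) f -> dle G C f F ->
  let m := max_solution G C A Phi ybar f in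
  fixed_points G C A Phi ybar f m /\
  forall x, C x -> hle C x (emb G ybar) ->
    hle C x (emb G (obstacle_solution G C A f (ext C Phi x))) ->
    hle C x (emb G m).
Proof.
move=> hybar f0 fF m.
pose S x := obstacle_solution G C A f (ext C Phi x).
have Ssol x : is_obstacle_solution G C A f (ext C Phi x) (S x).
  by apply: obstacle_solutionP; exact: ext_cone.
have SC x : C (emb G (S x)).
  by apply: obstacle_solution_ge0 (Ssol x) => //; exact: ext_cone.
have Sb x : hle C (emb G (S x)) (emb G ybar).
  exact: obstacle_solution_le fF hybar (Ssol x).
have Cb : C (emb G ybar) by exact: (hle_cone hC) (SC 0) (Sb 0).
have [h [Ch hb hT hmax]] : exists h, [/\ C h, hle C h (emb G ybar),
    emb G (S h) = h & forall x, C x -> hle C x (emb G ybar) ->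
      hle C x (emb G (S x)) -> hle C x h].
  apply: (@monotone_largest_fixpoint _ _ _ _ _ hC (fun x => emb G (S x))) => //.
  move=> x y Cx xy _; apply: obstacle_comparison (Ssol x) (Ssol y).
    by move=> v _; rewrite subrr.
  exact: ext_hle.
have -> : m = S h.
  apply: max_solution_largest; split=> [|y [/hle0 Cy yb yE]]; last first.
    by rewrite hT; apply: hmax => //; rewrite /S -yE; exact: (hle_refl hC).
  by split; rewrite hT //; apply/hle0.
split=> [|x]; last by rewrite hT; exact: hmax.
by split; rewrite hT //; apply/hle0.
Qed.

End Obstacle.

(** * Convergence of the largest solutions along decreasing forces *)

Theorem lemma4 (R : realType) (V H : completeNormedModType R)
  (G : gelfand_triple V H)
  (Hpos : set H) (hHpos : order_cone G Hpos)
  (N : nat) (mu : {measure set (borelRn R N) -> \bar R})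
  (Omega : set 'rV[R]_N) (rep : H -> borelRn R N -> R)
  (hfun : function_space mu Omega rep)
  (A : V -> dual V) (hA : operator G Hpos A)
  (Phi : H -> H) (hPhi : increasing_on_cone Hpos Phi)
  (F : dual V) (hF : dle G Hpos (fun=> 0) F)
  (ybar : V) (hybar : forall v, A ybar v = F v)
  (f_ : nat -> H) (fstar : H)
  (hf_pos : forall n, Hpos (f_ n))
  (hf_dual : forall n, dle G Hpos (fun=> 0) (to_dual G (f_ n)) /\
                       dle G Hpos (to_dual G (f_ n)) F)
  (hf_noninc : forall n, hle Hpos (f_ n.+1) (f_ n))
  (hf_lim : f_ n @[n --> \oo] --> fstar)
  (hPhi_cont : forall (v_ : nat -> V) (v : H),
    (exists B : R, forall n, `|v_ n| <= B) ->
    decreases_to Hpos (fun n => emb G (v_ n)) v ->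
    ext Hpos Phi (emb G (v_ n)) @[n --> \oo] --> ext Hpos Phi v) :
  let M := max_solution G Hpos A Phi ybar in
  decreases_to Hpos (fun n => emb G (M (to_dual G (f_ n))))
    (emb G (M (to_dual G fstar))) /\
  M (to_dual G (f_ n)) @[n --> \oo] --> M (to_dual G fstar).
Proof.
move=> M.
pose y_ n := M (to_dual G (f_ n)).
have yspec n := max_solution_spec hHpos hA hPhi hybar (hf_dual n).1 (hf_dual n).2.
have Cy n : Hpos (emb G (y_ n)) by apply/hle0; case: (yspec n).1.
have yb n : hle Hpos (emb G (y_ n)) (emb G ybar) by case: (yspec n).1.
have ysol n : is_obstacle_solution G Hpos A (to_dual G (f_ n))
    (ext Hpos Phi (emb G (y_ n))) (y_ n).
  have [_ _ yE] := (yspec n).1; rewrite [X in is_obstacle_solution _ _ _ _ _ X]yE.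
  exact: (obstacle_solutionP hHpos hA _ (ext_cone hHpos hPhi _)).
(* A fixed point [q] for a smaller force is a subsolution for [f_ n]. This is applied to [f_ n.+1]
   for monotonicity and to [fstar] for maximality of the limit. *)
have ymax n (f : H) q : hle Hpos f (f_ n) -> Hpos (emb G q) ->
    hle Hpos (emb G q) (emb G ybar) ->
    is_obstacle_solution G Hpos A (to_dual G f) (ext Hpos Phi (emb G q)) q ->
    hle Hpos (emb G q) (emb G (y_ n)).
  move=> ff Cq qb qsol; apply: (yspec n).2 => //.
  apply: (obstacle_comparison (f2 := to_dual G (f_ n)) hHpos hA _ (hle_refl hHpos _) qsol).
    move=> v /hle0 Cv; suff : 0 <= dotH G (f_ n - f) (emb G v).
      by rewrite dotDl dotNl; exact.
    exact: (cone_dot_ge0 hHpos).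
  exact: (obstacle_solutionP hHpos hA _ (ext_cone hHpos hPhi _)).
have ydec n : hle Hpos (emb G (y_ n.+1)) (emb G (y_ n)).
  exact: ymax (hf_noninc n) (Cy _) (yb _) (ysol _).
have [h [yh Ch hy]] := nonincreasing_cone_cvg hHpos Cy ydec.
have fstar_le n : hle Hpos fstar (f_ n).
  have [g [fg _ gf]] := nonincreasing_cone_cvg hHpos hf_pos hf_noninc.
  by rewrite (cvg_unique _ hf_lim fg).
have [c c0 amon] := opm_strongly_monotone hA.
(* As [0 <= f_ n <= f_ 0], the norm of [f_ 0] dominates all others and one bound serves for every
   [n]. *)
have [B yB] : exists B, forall n, `|y_ n| <= B.
  have f0 n : hle Hpos (f_ n) (f_ 0%N).
    elim: n => [|n]; first exact: (hle_refl hHpos).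
    exact: (hle_trans hHpos) (hf_noninc n).
  exists (`|f_ 0%N| * `|emb G ybar| / c + 1) => n.
  apply: le_trans (obstacle_solution_bound hHpos hA c0 amon _ (Cy n) (yb n) (ysol n)) _.
    exact: (ext_cone hHpos hPhi).
  by rewrite lerD2r ler_wpM2r ?invr_ge0 ?(ltW c0) // ler_wpM2r // (hle_norm hHpos).
have [p ph] := bounded_cvg_range (dotV_norm G) (@emb_continuous _ _ _ G) yB yh.
rewrite -ph {h ph} in yh Ch hy.
have psiE := hPhi_cont _ _ (ex_intro _ B yB) (conj ydec yh).
have pK : obstacle_set G Hpos (ext Hpos Phi (emb G p)) p.
  by apply: (hle_lim hHpos _ yh psiE); apply: nearW => n; case: (ysol n).
have pKn n v : obstacle_set G Hpos (ext Hpos Phi (emb G p)) v ->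
    obstacle_set G Hpos (ext Hpos Phi (emb G (y_ n))) v.
  by move=> pv; apply: (hle_trans hHpos) pv _; exact: (ext_hle hHpos hPhi).
have weak : A p (y_ n) @[n --> \oo] --> A p p.
  exact: (bounded_cvg_weak (dotV_norm G) (@emb_continuous _ _ _ G)
    (@emb_injective _ _ _ G) (dual_bounded_form (A p)) yB yh).
have yp : y_ n @[n --> \oo] --> p.
  apply/subr_cvg0.
  (* Strong monotonicity at [y_ n] and [p], combined with the inequality for [y_ n] tested at [p],
     leaves two terms: the first vanishes by convergence in [H], the second by weak convergence. *)
  apply: (@cvg_sqr0 _ _ _ (fun n => c^-1 *
    (dotH G (f_ n) (emb G (y_ n) - emb G p) - (A p (y_ n) - A p p)))).
    move=> n; rewrite ler_pdivlMl //; apply: le_trans (amon _ _) _.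
    have := (ysol n).2 _ (pKn n p pK).
    have fE : to_dual G (f_ n) (y_ n - p) =
      dotH G (f_ n) (emb G (y_ n) - emb G p) by rewrite -linearB.
    rewrite -(opprB (y_ n) p) !dualN -fE.
    by rewrite (bounded_formB (dual_bounded_form (A p))); lra.
  rewrite -(mulr0 c^-1); apply: cvgM; first exact: cvg_cst.
  rewrite -[X in _ --> X](subrr 0); apply: cvgB.
    have -> : 0 = dotH G fstar (emb G p - emb G p).
      by rewrite subrr -(scale0r (0 : H)) dotZr mul0r.
    apply: (dot_cvg (dotH_norm G)) => //.
    by apply: cvgB => //; exact: cvg_cst.
  by rewrite -(subrr (A p p : R)); apply: cvgB => //; exact: cvg_cst.
have psol : is_obstacle_solution G Hpos A (to_dual G fstar)
    (ext Hpos Phi (emb G p)) p.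
  (* Any [v] admissible for the limit obstacle is admissible for every [n]; as the Riesz
     representatives [a (y_ n)] converge in norm, both pairings pass to the limit. *)
  split => // v Kv; have [a ha [L alip]] := operator_riesz hA.
  have ay : a (y_ n) @[n --> \oo] --> a p.
    apply: (@cvg_dominated _ _ _ _ _ _ `|L| y_ p) => // n.
    by apply: le_trans (alip _ _) _; rewrite ler_wpM2r // ler_norm.
  have vy : v - y_ n @[n --> \oo] --> v - p by apply: cvgB => //; exact: cvg_cst.
  have cA : A (y_ n) (v - y_ n) @[n --> \oo] --> A p (v - p).
    rewrite ha; under eq_fun do rewrite ha.
    exact: (dot_cvg (dotV_norm G)).
  have cf : to_dual G (f_ n) (v - y_ n) @[n --> \oo] --> to_dual G fstar (v - p).
    apply: (dot_cvg (dotH_norm G)) => //.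
    by apply: continuous_cvg vy; exact: emb_continuous.
  apply: (ler_cvg_to (cvg_cst 0) (cvgB cA cf)); apply: nearW => n.
  exact: (ysol n).2 (pKn _ _ Kv).
suff -> : M (to_dual G fstar) = p by [].
apply: (max_solution_largest hHpos); split.
  split; first exact/hle0.
    apply: (hle_lim hHpos _ yh (cvg_cst (emb G ybar))).
    exact: nearW.
  apply: (obstacle_solution_unique hHpos hA psol).
  exact: (obstacle_solutionP hHpos hA _ (ext_cone hHpos hPhi _)).
(* Each [y_ n] dominates [q] because [fstar] lies below [f_ n], and the closed order passes to the
   limit. *)
move=> q [/hle0 Cq qb qE].
apply: (hle_lim hHpos _ (cvg_cst (emb G q)) yh).
apply: nearW => n; apply: (ymax n fstar) => //.
rewrite [X in is_obstacle_solution _ _ _ _ _ X]qE.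
exact: (obstacle_solutionP hHpos hA _ (ext_cone hHpos hPhi _)).
Qed.
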